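(* Let $R$ be a finite (left) nearfield with $|R|>2$, let $m$ be a positive integer, and let $V_m$ be the matrix with $m$ columns over $R$ constructed as described in the context. Then the number $k$ of rows of $V_m$ is $$k=\left\lceil \frac{|R|+\sqrt{|R|^2+8(|R|-2)m-8|R|+16}-4}{2(|R|-2)}\right\rceil .$$
   Context: A (left) nearfield is a triple $(R,+,\cdot)$ such that $(R,+)$ is a group, $(R\setminus\{0\},\cdot)$ is a group, multiplication is associative, and $a(b+c)=ab+ac$ for all $a,b,c\in R$. Construction of $V_m$. Let $S=R\setminus\{0,1\}$ with a fixed ordering. For $k\ge 1$ define matrices $W_k=[\,I_k\mid T_k\,]$ with $k$ rows, where $I_k$ is the identity matrix, $T_1$ is empty, and for $k\ge 2$ $$T_k=\left[\begin{array}{c|c} T_{k-1} & \\ 0\cdots 0 & B_k\end{array}\right],$$ i.e. $T_k$ consists of $T_{k-1}$ with a zero row appended at the bottom, followed by the $k$-row block $B_k$ whose columns are, for $c=1,2,\dots,k-1$ in turn and, for each $c$, for $s$ running through $S$ in order, the column $(1,\dots,1,s,\dots,s)^{\mathsf T}$ with $c$ entries equal to $1$ followed by $k-c$ entries equal to $s$. Let $k$ be the smallest integer such that $W_k$ has at least $m$ columns; $V_m$ is the matrix formed by the first $m$ columns of $W_k$. (Thus $V_1=(1)$; a new row is added only when all columns available with the current number of rows have been used.) *)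

(* Defs.v *)
From HB Require Import structures.
From mathcomp Require Import all_boot all_order all_algebra.
From mathcomp Require Import reals.

Set Implicit Arguments.
Unset Strict Implicit.
Unset Printing Implicit Defensive.

Declare Scope nearfield_scope.
Delimit Scope nearfield_scope with NF.

(* Left nearfields.  The additive group is not assumed to be commutative,
   which is why the structure does not extend zmodType.  The axioms from
   nf_mul_neq0 to nf_inv_ex say that the nonzero elements form a group. *)
HB.mixin Record isNearfield R of Choice R := {
  nf_zero : R;
  nf_add : R -> R -> R;
  nf_opp : R -> R;
  nf_one : R;
  nf_mul : R -> R -> R;
  nf_addA : associative nf_add;
  nf_add0x : left_id nf_zero nf_add;
  nf_addx0 : right_id nf_zero nf_add;
  nf_addNx : left_inverse nf_zero nf_opp nf_add;
  nf_addxN : right_inverse nf_zero nf_opp nf_add;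
  nf_mulA : associative nf_mul;
  nf_mul_neq0 : forall a b, a != nf_zero -> b != nf_zero -> nf_mul a b != nf_zero;
  nf_one_neq0 : nf_one != nf_zero;
  nf_mul1x : forall a, a != nf_zero -> nf_mul nf_one a = a;
  nf_mulx1 : forall a, a != nf_zero -> nf_mul a nf_one = a;
  nf_inv_ex : forall a, a != nf_zero ->
    exists2 b, b != nf_zero & nf_mul b a = nf_one /\ nf_mul a b = nf_one;
  nf_mulDr : forall a b c, nf_mul a (nf_add b c) = nf_add (nf_mul a b) (nf_mul a c)
}.

#[short(type="nearfieldType")]
HB.structure Definition Nearfield := {R of isNearfield R & Choice R}.

#[short(type="finNearfieldType")]
HB.structure Definition FinNearfield := {R of Nearfield R & Finite R}.

Bind Scope nearfield_scope with Nearfield.sort.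
Notation "0" := (@nf_zero _) : nearfield_scope.
Notation "1" := (@nf_one _) : nearfield_scope.
Infix "+" := (@nf_add _) : nearfield_scope.
Notation "- x" := (@nf_opp _ x) : nearfield_scope.
Infix "*" := (@nf_mul _) : nearfield_scope.

Local Open Scope nearfield_scope.

(* A fixed ordering of S = R \ {0, 1}: a duplicate-free list of its elements. *)
Definition ordering_of_S (R : nearfieldType) (S : seq R) : Prop :=
  uniq S /\ (forall x : R, (x \in S) = (x != 0) && (x != 1)).

Section Construction.

Variables (R : nearfieldType) (S : seq R).

(* (1, ..., 1, s, ..., s)^T, with c ones followed by k - c entries s *)
Definition B_col (k c : nat) (s : R) : 'cV[R]_k :=
  \col_(i < k) (if (i < c)%N then 1 else s).

Definition B_cols (k : nat) : seq 'cV[R]_k :=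
  [seq B_col k c s | c <- iota 1 k.-1, s <- S].

Definition B_mx (k : nat) : 'M[R]_(k, size (B_cols k)) :=
  \matrix_(i, j) tnth (in_tuple (B_cols k)) j i ord0.

(* The recursion starts from the 0 x 0 matrix; as B_mx 1 has no columns,
   T_mx 1 is the empty matrix with one row. *)
Fixpoint T_ncols (k : nat) : nat :=
  if k is k'.+1 then (T_ncols k' + size (B_cols k'.+1))%N else 0%N.

Fixpoint T_mx (k : nat) : 'M[R]_(k, T_ncols k) :=
  match k return 'M[R]_(k, T_ncols k) with
  | 0%N => const_mx 0
  | k'.+1 =>
      row_mx (castmx (addn1 k', erefl)
                (col_mx (T_mx k') (const_mx 0 : 'rV[R]_(T_ncols k'))))
             (B_mx k'.+1)
  end.

Definition W_ncols (k : nat) : nat := (k + T_ncols k)%N.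

Definition W_mx (k : nat) : 'M[R]_(k, W_ncols k) :=
  row_mx (\matrix_(i, j) (if i == j then 1 else 0)) (T_mx k).

Lemma ex_V_nrows (m : nat) : exists k, (0 < k)%N && (m <= W_ncols k)%N.
Proof. by exists m.+1; rewrite /= (leq_trans (leqnSn m)) // leq_addr. Qed.

Definition V_nrows (m : nat) : nat := ex_minn (ex_V_nrows m).

Lemma V_ncols_le (m : nat) : (m <= W_ncols (V_nrows m))%N.
Proof. by rewrite /V_nrows; case: ex_minnP => k /andP[]. Qed.

Definition V_mx (m : nat) : 'M[R]_(V_nrows m, m) :=
  colsub (widen_ord (V_ncols_le m)) (W_mx (V_nrows m)).

End Construction.

Definition nrows (A : Type) (m n : nat) (M : 'M[A]_(m, n)) : nat := m.

(* Main.v *)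
Require Import Defs.
From mathcomp Require Import all_boot all_order all_algebra.
From mathcomp Require Import reals.
From mathcomp Require Import ring lra zify.

(** [W_k] has [k + d * k(k - 1)/2] columns, where [d = |R| - 2], so the number of
    rows is the least [k] at which the quadratic
    [d k^2 - (d - 2) k - 2 m] becomes nonnegative, i.e. the ceiling of its
    positive root. *)

Import Order.TTheory GRing.Theory Num.Theory.

Local Open Scope ring_scope.

Lemma size_ordering (R : finNearfieldType) (S : seq R) :
  ordering_of_S S -> size S = (#|R| - 2)%N.
Proof.
case=> uniqS memS; rewrite -(card_uniqP uniqS).
have eqS : S =i [predC [set nf_zero; nf_one : R]].
  by move=> x; rewrite memS !inE negb_or.
have := cardC [set nf_zero; nf_one : R].
by rewrite cards2 eq_sym nf_one_neq0 (eq_card eqS) => <-; rewrite addKn.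
Qed.

(** The block [B_cols k] adds [k.-1 * size S] columns, so [T_ncols] is a triangular sum; doubling
    avoids a division in [nat]. *)
Lemma W_ncols_double (R : nearfieldType) (S : seq R) k :
  (2 * W_ncols S k)%N = (2 * k + size S * (k * k.-1))%N.
Proof.
rewrite /W_ncols mulnDr; congr addn.
elim: k => [|k IHk]; first by rewrite !muln0.
rewrite [T_ncols S k.+1]/= mulnDr IHk size_allpairs size_iota.
by case: k {IHk} => [|k] /=; lia.
Qed.

(** Completing the square: [(2dx - (d - 2))^2] minus the radicand is [4d (2x + d x (x - 1) - 2m)].
    As [1 <= x], the squared term is positive, so the comparison of squares passes to the roots. *)
Lemma ler_quadratic_root (F : rcfType) (d m x : F) :
  0 < d -> 1 <= x -> 2 * m <= 2 * x + d * (x * (x - 1)) ->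
  (d - 2 + Num.sqrt ((d - 2) ^+ 2 + 8 * d * m)) / (2 * d) <= x.
Proof.
move=> d_gt0 x_ge1 le_m; rewrite ler_pdivrMr; last by lra.
have y_ge0 : 0 <= 2 * d * x - (d - 2) by nra.
suff : Num.sqrt ((d - 2) ^+ 2 + 8 * d * m) <= 2 * d * x - (d - 2) by lra.
by rewrite -[leRHS]ger0_norm // -sqrtr_sqr ler_wsqrtr //; nra.
Qed.

Lemma ltr_quadratic_root (F : rcfType) (d m x : F) :
  0 < d -> 0 < m -> 2 * x + d * (x * (x - 1)) < 2 * m ->
  x < (d - 2 + Num.sqrt ((d - 2) ^+ 2 + 8 * d * m)) / (2 * d).
Proof.
move=> d_gt0 m_gt0 lt_m; rewrite ltr_pdivlMr; last by lra.
suff : 2 * d * x - (d - 2) < Num.sqrt ((d - 2) ^+ 2 + 8 * d * m) by lra.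
(* Bounding by the absolute value spares a sign discussion; the strict comparison of roots needs a
   positive radicand, which [0 < m] provides. *)
rewrite (le_lt_trans (ler_norm _)) // -sqrtr_sqr ltr_sqrt; last first.
  by rewrite ltr_wpDl ?sqr_ge0 // !mulr_gt0.
by nra.
Qed.

Theorem lemma4p10 (F : realType) (R : finNearfieldType) (S : seq R) (m : nat)
    (hR : (2 < #|R|)%N) (hS : ordering_of_S S) (hm : (0 < m)%N) :
  let q : F := #|R|%:R in
  Posz (nrows (V_mx S m)) =
  Num.ceil ((q + Num.sqrt (q ^+ 2 + 8 * (q - 2) * m%:R - 8 * q + 16) - 4)
            / (2 * (q - 2))).
Proof.
move=> q; pose d : F := q - 2.
have sizeS : (size S)%:R = d by rewrite (size_ordering _ _ hS) natrB // ltnW.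
have d_gt0 : 0 < d by rewrite subr_gt0 ltr_nat.
have -> : (q + Num.sqrt (q ^+ 2 + 8 * (q - 2) * m%:R - 8 * q + 16) - 4)
            / (2 * (q - 2)) =
    (d - 2 + Num.sqrt ((d - 2) ^+ 2 + 8 * d * m%:R)) / (2 * d).
  have -> : q ^+ 2 + 8 * (q - 2) * m%:R - 8 * q + 16 =
            (d - 2) ^+ 2 + 8 * d * m%:R by rewrite /d; ring.
  by congr (_ / _); rewrite /d; ring.
have W_natr j : 2 * (W_ncols S j)%:R = 2 * j%:R + d * (j%:R * (j%:R - 1)) :> F.
  rewrite -natrM W_ncols_double natrD !natrM sizeS.
  (* At [j = 0] the truncated [j.-1] differs from [j - 1] in [F], but the factor [j] kills both
     products. *)
  by case: j => [|j]; rewrite ?mul0r //= -[j.+1%:R]natr1 addrK.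
rewrite /nrows /V_nrows; case: ex_minnP => [[//|k]] /andP[_ le_m] min_k.
(* With [k.+1] rows, the root must lie in the interval from [k] (excluded) to [k.+1] (included). *)
apply/esym/ceil_def/andP; split.
  rewrite -addn1 PoszD addrK.
  apply: ltr_quadratic_root; rewrite ?ltr0n // -W_natr ltr_pM2l // ltr_nat.
  (* Minimality ranges over positive row counts only; for zero rows, [W_ncols S 0 = 0 < m]
     directly. *)
  case: k min_k {le_m} => [|k] min_k; first by rewrite /W_ncols.
  by rewrite ltnNge; apply/negP => le_m; have := min_k k.+1 le_m; rewrite ltnn.
apply: ler_quadratic_root; rewrite ?ler1n //.
by rewrite -W_natr ler_pM2l // ler_nat.
Qed.
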